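(* Let $r\ge1$, $\mathbf n=(n_1,\dots,n_r)\in\mathbb N_0^r$, $\mathbf a,\mathbf b\in\mathbb R^{r+1}$, $\mathbf x\in\mathbb C^r$, such that no lower parameter of the ${}_3F_2$'s occurring below is a nonpositive integer and no denominator below vanishes. Then $$E_0\;{}_rS_{\mathbf n}(\mathbf x;\mathbf a,\mathbf b)+E_1\;{}_rS_{\mathbf n}(\mathbf x;\mathbf a,b_1-1,b_2,\dots,b_{r+1})+E_2\;{}_rS_{\mathbf n}(\mathbf x;\mathbf a,b_1-2,b_2,\dots,b_{r+1})=0,$$ where $$E_0=-\frac{b_1-1+\frac{x_1}{2}}{n_1+2|\mathbf n^2|+|\mathbf a|+|\mathbf b|-1},$$ $$E_1=\frac{\big(2|\mathbf n^2|+|\mathbf a^2|+|\mathbf b^2|\big)\big(|\mathbf n^2|+|\mathbf a|\big)+n_1\big(|\mathbf n^2|+|\mathbf a^2|+\frac{x_1}{2}\big)}{\big(n_1+2|\mathbf n^2|+|\mathbf a|+|\mathbf b|-2\big)_2}+\frac{n_1-|\mathbf n^2|-|\mathbf a^2|+2b_1-3+\frac{x_1}{2}}{n_1+2|\mathbf n^2|+|\mathbf a|+|\mathbf b|-1},$$ $$E_2=-\frac{(n_1+a_1+b_1-2)\big(|\mathbf n|+|\mathbf b|-2\big)}{\big(n_1+2|\mathbf n^2|+|\mathbf a|+|\mathbf b|-2\big)_2}.$$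
   Context: Notation: $(c)_k=c(c+1)\cdots(c+k-1)$, $(c)_0=1$; ${}_3F_2\left(\begin{matrix}c_1,c_2,c_3\\ d_1,d_2\end{matrix}\Big|z\right)=\sum_{k\ge0}\frac{(c_1)_k(c_2)_k(c_3)_k}{(d_1)_k(d_2)_k}\frac{z^k}{k!}$ (a finite sum when $c_1=-n$, $n\in\mathbb N_0=\{0,1,\dots\}$). For $r\ge1$, $\mathbf n=(n_1,\dots,n_r)$, $\mathbf a=(a_1,\dots,a_{r+1})$, $\mathbf b=(b_1,\dots,b_{r+1})$: $|\mathbf n^j|=n_j+\cdots+n_r$ with $|\mathbf n^{r+1}|=0$, $|\mathbf a^j|=a_j+\cdots+a_{r+1}$, $|\mathbf b^j|=b_j+\cdots+b_{r+1}$, and $|\mathbf n|=|\mathbf n^1|$, $|\mathbf a|=|\mathbf a^1|$, $|\mathbf b|=|\mathbf b^1|$. For $\mathbf x=(x_1,\dots,x_r)$, $${}_rS_{\mathbf n}(\mathbf x;\mathbf a,\mathbf b)=\prod_{j=1}^r\left\{\Big(|\mathbf a^{j+1}|+\frac{x_j}{2}\Big)_{|\mathbf n^{j+1}|}\;{}_3F_2\left(\begin{matrix}-n_j,\;n_j+2|\mathbf n^{j+1}|+|\mathbf a^j|+|\mathbf b^j|-1,\;|\mathbf n^{j+1}|+|\mathbf a^{j+1}|+\frac{x_j}{2}\\ 2|\mathbf n^{j+1}|+|\mathbf a^{j+1}|+|\mathbf b^{j+1}|,\;|\mathbf n^{j+1}|+|\mathbf a^j|\end{matrix}\,\Big|\,1\right)\right\}.$$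 *)

(* Defs.v *)
From HB Require Import structures.
From mathcomp Require Import all_boot all_order all_algebra.
From mathcomp Require Import complex.
From mathcomp Require Import all_classical all_reals topology normedtype sequences.

Set Implicit Arguments.
Unset Strict Implicit.
Unset Printing Implicit Defensive.

Import Order.TTheory GRing.Theory Num.Theory.
Import numFieldNormedType.Exports.

Local Open Scope ring_scope.
Local Open Scope complex_scope.
Local Open Scope classical_set_scope.

Definition poch (F : pzRingType) (c : F) (k : nat) : F :=
  \prod_(i < k) (c + i%:R).

Definition hyp3F2_term (F : unitRingType) (c1 c2 c3 d1 d2 z : F) (k : nat) : F :=
  poch c1 k * poch c2 k * poch c3 k / (poch d1 k * poch d2 k) * (z ^+ k / k`!%:R).

Definition hyp3F2 (K : numFieldType) (c1 c2 c3 d1 d2 z : K) : K :=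
  limn (series (hyp3F2_term c1 c2 c3 d1 d2 z)).

Lemma poch_opp_nat (F : pzRingType) (n k : nat) :
  (n < k)%N -> poch (- n%:R : F) k = 0.
Proof.
move=> ltnk; rewrite /poch -(big_mkord xpredT (fun i => - n%:R + i%:R : F)).
rewrite (big_cat_nat (leq0n n) (ltnW ltnk)) /= [X in _ * X]big_ltn //.
by rewrite addNr mul0r mulr0.
Qed.

Lemma hyp3F2_terminating (K : numFieldType) (n : nat) (c2 c3 d1 d2 z : K) :
  hyp3F2 (- n%:R) c2 c3 d1 d2 z =
  \sum_(k < n.+1) hyp3F2_term (- n%:R) c2 c3 d1 d2 z k.
Proof.
apply: lim_near_cst; first exact: (@norm_hausdorff K K^o).
exists n.+1 => // m /= ltnm.
rewrite /series /= (big_cat_nat (leq0n n.+1) ltnm) /=.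
rewrite [X in _ + X]big_nat_cond [X in _ + X]big1 ?addr0 ?big_mkord //.
move=> k /andP[/andP[ltnk _] _].
by rewrite /hyp3F2_term poch_opp_nat // !mul0r.
Qed.

(* Indices start at 0: the sum v_j + v_(j+1) + ... of the entries numbered
   from 1 is [tail v j.-1] here, so that |n^2| is [tail n 1] and |n| is
   [tail n 0]; an index past the end gives the empty sum. *)
Definition tail (V : nmodType) (m : nat) (v : 'I_m -> V) (j : nat) : V :=
  \sum_(i < m | (j <= i)%N) v i.

Section MultivariateS.

Variables (R : realType) (r : nat).
Implicit Types (n : 'I_r -> nat) (x : 'I_r -> R[i]) (a b : 'I_r.+1 -> R).

Definition lower1 n a b (j : 'I_r) : R :=
  2 * (tail n j.+1)%:R + tail a j.+1 + tail b j.+1.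

Definition lower2 n a (j : 'I_r) : R := (tail n j.+1)%:R + tail a j.

Definition rS n x a b : R[i] :=
  \prod_(j < r)
    (poch ((tail a j.+1)%:C + x j / 2) (tail n j.+1) *
     hyp3F2 (- (n j)%:R)
            ((n j)%:R + 2 * (tail n j.+1)%:R + tail a j + tail b j - 1)%:C
            (((tail n j.+1)%:R + tail a j.+1)%:C + x j / 2)
            (lower1 n a b j)%:C
            (lower2 n a j)%:C
            1).

Definition shift_b1 b (c : R) : 'I_r.+1 -> R :=
  [eta b with ord0 |-> b ord0 - c].

Section Coefficients.

Variables (r_gt0 : (0 < r)%N).
Variables (n : 'I_r -> nat) (x : 'I_r -> R[i]) (a b : 'I_r.+1 -> R).

Let i1 : 'I_r := Ordinal r_gt0.
Let n1 : R := (n i1)%:R.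
Let N2 : R := (tail n 1)%:R.
Let a1 : R := a ord0.
Let b1 : R := b ord0.
Let hx1 : R[i] := x i1 / 2.

(* [den c] is n_1 + 2|n^2| + |a| + |b| - c *)
Definition den (c : R) : R := n1 + 2 * N2 + tail a 0 + tail b 0 - c.

Definition E0 : R[i] := - (((b1 - 1)%:C + hx1) / (den 1)%:C).

Definition E1 : R[i] :=
  (((2 * N2 + tail a 1 + tail b 1) * (N2 + tail a 0))%:C
     + n1%:C * ((N2 + tail a 1)%:C + hx1)) / (poch (den 2) 2)%:C
  + ((n1 - N2 - tail a 1 + 2 * b1 - 3)%:C + hx1) / (den 1)%:C.

Definition E2 : R[i] :=
  - (((n1 + a1 + b1 - 2) * ((tail n 0)%:R + tail b 0 - 2))%:C
     / (poch (den 2) 2)%:C).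

End Coefficients.

End MultivariateS.

(* Main.v *)
(* The b_1-shift only affects the factor j = 1, so the relation is one between
   3F2(-n, u+1, c), 3F2(-n, u, c) and 3F2(-n, u-1, c) at 1 with common lower
   parameters d, e, where u = n_1 + 2|n^2| + |a| + |b| - 2. It follows by
   creative telescoping: the k-th term of the combination, cleared of
   denominators, is G_(k+1) - G_k with
   G_k = - (u)_(k-1) (-n)_k (c)_k / ((d)_(k-1) (e)_(k-1) (k-1)!),
   and G_0 = G_(n+1) = 0. *)
Require Import Defs.
From mathcomp Require Import all_boot all_order all_algebra.
From mathcomp Require Import complex.
From mathcomp Require Import all_classical all_reals.
From mathcomp Require Import ring.

Import GRing.Theory Num.Theory.

Local Open Scope ring_scope.
Local Open Scope complex_scope.

Lemma poch0 (F : pzRingType) (c : F) : poch c 0 = 1.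
Proof. by rewrite /poch big_ord0. Qed.

Lemma pochS (F : pzRingType) (c : F) (k : nat) :
  poch c k.+1 = poch c k * (c + k%:R).
Proof. by rewrite /poch big_ord_recr. Qed.

Lemma pochSl (F : pzRingType) (c : F) (k : nat) :
  poch c k.+1 = c * poch (c + 1) k.
Proof.
rewrite /poch big_ord_recl addr0; congr (_ * _).
by apply: eq_bigr => i _; rewrite lift0 -addrA -natr1 [1 + _]addrC.
Qed.

Lemma poch_neq0 (F : idomainType) (c : F) (k : nat) :
  (forall m : nat, c + m%:R != 0) -> poch c k != 0.
Proof. by move=> c_ok; apply/prodf_neq0 => i _. Qed.

Section Contiguity.

Variables (K : numFieldType) (c d e u : K).
Hypothesis d_ok : forall m : nat, d + m%:R != 0.
Hypothesis e_ok : forall m : nat, e + m%:R != 0.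

(** The telescoped form, whose right-hand side is G_(m+1) with [p] in place of -n. With [p] free,
    each induction step is an identity of rational functions; termination enters only afterwards, by
    taking [p] = -n and [m] = n. *)
Lemma hyp3F2_contiguous_partial_sum (p : K) (m : nat) :
  \sum_(k < m.+1)
    (- u * (u + 1 + p - d - e + c) * hyp3F2_term p (u + 1) c d e 1 k
     + (d * e - p * c + u * (2 * u + 1 + p - 2 * d - 2 * e + c))
         * hyp3F2_term p u c d e 1 k
     - (u - d) * (u - e) * hyp3F2_term p (u - 1) c d e 1 k)
  = - (poch u m * poch p m.+1 * poch c m.+1
       / (poch d m * poch e m * m`!%:R)).
Proof.
elim: m => [|m IHm].
  by rewrite big_ord1 /hyp3F2_term !pochS !poch0 fact0 expr0; field.
rewrite big_ord_recr /= IHm /hyp3F2_term expr1n.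
(* All Pochhammer symbols in [u - 1], [u] and [u + 1] are reduced to [poch u m], so that [field]
   sees a single atom. *)
have -> : poch (u - 1) m.+1 = (u - 1) * poch u m by rewrite pochSl subrK.
(* Since [u] may be 0, this is not solved for [poch (u + 1) m.+1]. The factor [u] in the coefficient
   of that term is used instead: [PE] replaces the whole product. *)
have upochE : u * poch (u + 1) m.+1 = poch u m * (u + m%:R) * (u + m.+1%:R).
  by rewrite -pochSl !pochS.
set P := poch (u + 1) m.+1 in upochE *.
have PE s t : - u * s * (poch p m.+1 * P * t) =
    - s * (poch p m.+1 * (poch u m * (u + m%:R) * (u + m.+1%:R)) * t).
  by rewrite -upochE; ring.
rewrite -[poch p m.+1 * P * poch c m.+1 / _ * _]mulrA.
rewrite -[poch p m.+1 * P * poch c m.+1 * _]mulrA PE.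
rewrite [poch p m.+2]pochS [poch c m.+2]pochS [poch u m.+1]pochS.
rewrite [poch d m.+1]pochS [poch e m.+1]pochS factS natrM -!natr1.
field.
by rewrite ?poch_neq0 ?d_ok ?e_ok ?natr1 ?pnatr_eq0 -?lt0n ?fact_gt0.
Qed.

Lemma hyp3F2_contiguous (n : nat) :
  - u * (u + 1 - n%:R - d - e + c) * hyp3F2 (- n%:R) (u + 1) c d e 1
  + (d * e + n%:R * c + u * (2 * u + 1 - n%:R - 2 * d - 2 * e + c))
      * hyp3F2 (- n%:R) u c d e 1
  - (u - d) * (u - e) * hyp3F2 (- n%:R) (u - 1) c d e 1 = 0.
Proof.
have := hyp3F2_contiguous_partial_sum (- n%:R) n.
rewrite poch_opp_nat // mulr0 !mul0r oppr0 !big_split /= sumrN -!mulr_sumr.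
by rewrite -!hyp3F2_terminating [- n%:R * c]mulNr opprK.
Qed.

End Contiguity.

Lemma tail0 (V : nmodType) (m : nat) (m_gt0 : (0 < m)%N) (v : 'I_m -> V) :
  tail v 0 = v (Ordinal m_gt0) + tail v 1.
Proof.
rewrite /tail (bigD1 (Ordinal m_gt0)) //=; congr (_ + _).
by apply: eq_bigl => i; rewrite -val_eqE /= lt0n.
Qed.

Lemma tail_shift_b1_0 (R : realType) (r : nat) (b : 'I_r.+1 -> R) (c : R) :
  tail (shift_b1 b c) 0 = tail b 0 - c.
Proof.
rewrite !(tail0 _ _ (ltn0Sn r)) /tail addrAC.
have -> : Ordinal (ltn0Sn r) = ord0 by apply: val_inj.
rewrite {1}/shift_b1 /=; congr (_ + _).
by apply: eq_bigr => i; rewrite lt0n /shift_b1 /= -val_eqE => /negPf ->.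
Qed.

Lemma tail_shift_b1_S (R : realType) (r : nat) (b : 'I_r.+1 -> R) (c : R)
    (j : nat) :
  tail (shift_b1 b c) j.+1 = tail b j.+1.
Proof.
apply: eq_bigr => i /(leq_ltn_trans (leq0n j)).
by rewrite lt0n /shift_b1 /= -val_eqE => /negPf ->.
Qed.

Lemma realC_add_nat_neq0 (R : realType) (y : R) :
  (forall m : nat, y <> - m%:R) -> forall m : nat, y%:C + m%:R != 0.
Proof.
move=> y_ok m; rewrite -(rmorph_nat (real_complex R)) -rmorphD /= fmorph_eq0.
by rewrite addr_eq0; apply/eqP/y_ok.
Qed.

(** The part of [rS] that is free of b_1. It keeps the Pochhammer prefactor of j = 1, which involves
    no b, and leaves out only the 3F2 of j = 1. *)
Definition rS_cofactor {R : realType} {r : nat} (r_gt0 : (0 < r)%N)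
    (n : 'I_r -> nat) (x : 'I_r -> R[i]) (a b : 'I_r.+1 -> R) : R[i] :=
  poch ((tail a 1)%:C + x (Ordinal r_gt0) / 2) (tail n 1) *
  \prod_(j < r | j != Ordinal r_gt0)
    (poch ((tail a j.+1)%:C + x j / 2) (tail n j.+1) *
     hyp3F2 (- (n j)%:R)
            ((n j)%:R + 2 * (tail n j.+1)%:R + tail a j + tail b j - 1)%:C
            (((tail n j.+1)%:R + tail a j.+1)%:C + x j / 2)
            (lower1 n a b j)%:C
            (lower2 n a j)%:C
            1).

Section FirstFactor.

Variables (R : realType) (r : nat) (r_gt0 : (0 < r)%N).
Variables (n : 'I_r -> nat) (x : 'I_r -> R[i]) (a b : 'I_r.+1 -> R).
Let i1 := Ordinal r_gt0.

Lemma rS_first_factor :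
  rS n x a b = rS_cofactor r_gt0 n x a b *
    hyp3F2 (- (n i1)%:R) (den r_gt0 n a b 1)%:C
           (((tail n 1)%:R + tail a 1)%:C + x i1 / 2)
           (lower1 n a b i1)%:C (lower2 n a i1)%:C 1.
Proof. by rewrite /rS (bigD1 i1) //= mulrAC. Qed.

Lemma lower1_shift_b1 (t : R) (j : 'I_r) :
  lower1 n a (shift_b1 b t) j = lower1 n a b j.
Proof. by rewrite /lower1 tail_shift_b1_S. Qed.

Lemma rS_cofactor_shift_b1 (t : R) :
  rS_cofactor r_gt0 n x a (shift_b1 b t) = rS_cofactor r_gt0 n x a b.
Proof.
rewrite /rS_cofactor.
apply: (congr1 ( *%R _)).
apply: eq_bigr => j.
(* Away from the first index, [j] is a successor, so [tail b j] does not contain b_1. *)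
rewrite -val_eqE /= -lt0n => /prednK jE.
by rewrite lower1_shift_b1 -jE tail_shift_b1_S jE.
Qed.

Lemma den_shift_b1 (s t : R) :
  den r_gt0 n a (shift_b1 b t) s = den r_gt0 n a b (s + t).
Proof. by rewrite /den tail_shift_b1_0; ring. Qed.

End FirstFactor.

Theorem theorem5p15 (R : realType) (r : nat) (r_gt0 : (0 < r)%N)
    (n : 'I_r -> nat) (a b : 'I_r.+1 -> R) (x : 'I_r -> R[i])
    (* the lower parameters do not involve b_1, hence are the same for the
       three shifted functions *)
    (lower1_ok : forall (j : 'I_r) (m : nat), lower1 n a b j <> - m%:R)
    (lower2_ok : forall (j : 'I_r) (m : nat), lower2 n a j <> - m%:R)
    (den1_neq0 : den r_gt0 n a b 1 <> 0)
    (den2_neq0 : poch (den r_gt0 n a b 2) 2 <> 0) :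
  E0 r_gt0 n x a b * rS n x a b
  + E1 r_gt0 n x a b * rS n x a (shift_b1 b 1)
  + E2 r_gt0 n a b * rS n x a (shift_b1 b 2) = 0.
Proof.
rewrite !(rS_first_factor _ _ r_gt0) !rS_cofactor_shift_b1 !den_shift_b1.
rewrite !lower1_shift_b1.
set i1 := Ordinal r_gt0; set Q := rS_cofactor _ _ _ _ _.
set c := _ + x i1 / 2; set d := (lower1 _ _ _ _)%:C; set e := (lower2 _ _ _)%:C.
(* The middle one of the three upper parameters: shifting b_1 by 0, 1, 2 gives [u + 1], [u],
   [u - 1]. *)
set U := den r_gt0 n a b 2; set u := U%:C.
have den1E : den r_gt0 n a b 1 = U + 1 by rewrite /U /den; ring.
have den3E : den r_gt0 n a b (1 + 2) = U - 1 by rewrite /U /den; ring.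
have poch2E : poch U 2 = U * (U + 1) by rewrite !pochS poch0 addr0 mul1r.
have u_neq0 : u != 0.
  rewrite fmorph_eq0; apply/eqP => U0.
  by apply: den2_neq0; rewrite poch2E U0 mul0r.
have u1_neq0 : u + 1 != 0.
  rewrite -(rmorph1 (real_complex R)) -rmorphD /= fmorph_eq0 -den1E.
  exact/eqP.
rewrite den1E den3E.
have u1E : (U + 1)%:C = u + 1 by rewrite rmorphD rmorph1.
have uu1E : (U * (U + 1))%:C = u * (u + 1) by rewrite rmorphM /= u1E.
rewrite u1E.
have -> : (U - 1)%:C = u - 1 by rewrite rmorphB rmorph1.
have rel := @hyp3F2_contiguous _ c d e u
  (realC_add_nat_neq0 _ _ (lower1_ok i1))
  (realC_add_nat_neq0 _ _ (lower2_ok i1)) (n i1).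
have ord0E : Ordinal (ltn0Sn r) = ord0 by apply: val_inj.
have a0E := tail0 _ _ (ltn0Sn r) a; have b0E := tail0 _ _ (ltn0Sn r) b.
rewrite ord0E in a0E b0E; have n0E := tail0 _ _ r_gt0 n.
(* Each E_i is the matching coefficient of [rel] divided by u (u + 1); in E_0 the factor [u]
   cancels. *)
have E0E : E0 r_gt0 n x a b = - (u + 1 - (n i1)%:R - d - e + c) / (u + 1).
  rewrite /E0 den1E /u /c /d /e /U /den /lower1 /lower2 /= a0E b0E.
  rewrite ?(rmorphD, rmorphB, rmorphM, rmorphN, rmorph1, rmorph_nat) /=.
  rewrite -mulNr; congr (_ / _); ring.
have E1E : E1 r_gt0 n x a b =
    (d * e + (n i1)%:R * c
     + u * (2 * u + 1 - (n i1)%:R - 2 * d - 2 * e + c)) / (u * (u + 1)).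
  (* This split matches the two fractions in the definition of [E1] numerator by numerator. *)
  have -> : E1 r_gt0 n x a b = (d * e + (n i1)%:R * c) / (u * (u + 1))
      + (2 * u + 1 - (n i1)%:R - 2 * d - 2 * e + c) / (u + 1).
    rewrite /E1 -/U poch2E den1E.
    congr (_ / _ + _ / _).
    - rewrite /c /d /e /lower1 /lower2 /=.
      rewrite ?(rmorphD, rmorphB, rmorphM, rmorph1, rmorph_nat) /=; ring.
    - exact: uu1E.
    - rewrite /u /c /d /e /U /den /lower1 /lower2 /= a0E b0E.
      rewrite ?(rmorphD, rmorphB, rmorphM, rmorph1, rmorph_nat) /=; ring.
    - exact: u1E.
  by field; rewrite u_neq0 u1_neq0.
(* Here u - d = n_1 + a_1 + b_1 - 2 and u - e = |n| + |b| - 2. *)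
have E2E : E2 r_gt0 n a b = - ((u - d) * (u - e)) / (u * (u + 1)).
  rewrite /E2 -/U poch2E -mulNr; congr (_ / _).
    rewrite /u /d /e /U /den /lower1 /lower2 /= a0E b0E n0E natrD.
    rewrite ?(rmorphD, rmorphB, rmorphM, rmorph1, rmorph_nat) /=; ring.
  exact: uu1E.
rewrite E0E E1E E2E; move: rel.
set F0 := hyp3F2 _ (u + 1) _ _ _ _; set F1 := hyp3F2 _ u _ _ _ _.
set F2 := hyp3F2 _ (u - 1) _ _ _ _.
clearbody F0 F1 F2 u c d e Q => rel.
(* The goal is [rel] multiplied by Q / (u (u + 1)). *)
rewrite -[RHS](mulr0 (Q / (u * (u + 1)))) -rel; field.
by rewrite u_neq0 u1_neq0.
Qed.
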